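(* Let $C$ be a nonempty closed convex subset of a complete Busemann space $X$ and let $T:C\to C$ be nonexpansive. For $t\in(0,1)$ let $U_t:C\to C$ be the mapping assigning to each $x\in C$ the unique fixed point $U_t(x)\in C$ of the contraction $C\to C$, $y\mapsto(1-t)x\oplus tT(y)$, so that $U_t(x)=(1-t)x\oplus tT(U_t(x))$. Then, for every $t\in(0,1)$, $U_t$ is a firmly nonexpansive mapping having the same set of fixed points as $T$.
   Context: Let $(X,d)$ be a metric space. A geodesic in $X$ is a map $\gamma:[a,b]\to X$ with $d(\gamma(s),\gamma(t))=|s-t|$ for all $s,t\in[a,b]$; its image is a geodesic segment joining $\gamma(a)$ and $\gamma(b)$. $X$ is a (uniquely) geodesic space if every two distinct points are joined by a (unique) geodesic segment. A map $\gamma:[a,b]\to X$ is an affinely reparametrized geodesic if it is constant or if $\gamma=\gamma'\circ\psi$ for some geodesic $\gamma':[c,d]\to X$, where $\psi:[a,b]\to[c,d]$ is the unique (increasing) affine homeomorphism. A geodesic space $X$ is a Busemann space if for any two affinely reparametrized geodesics $\gamma:[a,b]\to X$, $\gamma':[c,d]\to X$ the map $(s,t)\mapsto d(\gamma(s),\gamma'(t))$ is convex on $[a,b]\times[c,d]$. Busemann spaces are uniquely geodesic; for $x,y\in X$ and $\lambda\in[0,1]$, $(1-\lambda)x\oplus\lambda y$ denotes the unique point $z$ with $d(x,z)=\lambda d(x,y)$ and $d(y,z)=(1-\lambda)d(x,y)$. A subset $C$ is convex if $(1-\lambda)x\oplus\lambda y\in C$ for all $x,y\in C$, $\lambda\in[0,1]$.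 A map $T:C\to X$ is nonexpansive if $d(Tx,Ty)\le d(x,y)$ for all $x,y\in C$, and firmly nonexpansive if $d(Tx,Ty)\le d((1-\lambda)x\oplus\lambda Tx,(1-\lambda)y\oplus\lambda Ty)$ for all $x,y\in C$ and all $\lambda\in(0,1)$. *)

(* Defs.v *)
From HB Require Import structures.
From mathcomp Require Import all_boot all_order all_algebra.
From mathcomp Require Import all_classical all_reals all_analysis.

Set Implicit Arguments.
Unset Strict Implicit.
Unset Printing Implicit Defensive.

Import Order.TTheory GRing.Theory Num.Theory.
Import numFieldNormedType.Exports.

Local Open Scope classical_set_scope.
Local Open Scope ring_scope.

#[short(type="completeMetricType")]
HB.structure Definition CompleteMetric (K : numDomainType) :=
  {M of Metric K M & Complete M}.

Section geodesics.
Context {R : realType} {X : metricType R}.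

(* A map [a, b] -> X is represented by a total function R -> X of which only
   the values on [a, b] matter. *)
Definition geodesic (a b : R) (g : R -> X) : Prop :=
  a <= b /\ {in `[a, b] &, forall s t, mdist (g s) (g t) = `|s - t|}.

Definition geodesic_segment (x y : X) (S : set X) : Prop :=
  exists a b g, [/\ geodesic a b g, g a = x, g b = y & S = g @` `[a, b]].

(* [line_path c d \o factor a b] is the increasing affine bijection from
   [a, b] to [c, d]; for a = b every map is constant on [a, b]. *)
Definition affine_geodesic (a b : R) (g : R -> X) : Prop :=
  a <= b /\
  ((exists x, {in `[a, b], forall s, g s = x}) \/
   (exists c d g',
      [/\ a < b, c < d, geodesic c d g' &
          {in `[a, b], forall s, g s = g' (line_path c d (factor a b s))}])).

End geodesics.

Section busemann.
Context {R : realType}.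

Definition geodesic_space (X : metricType R) : Prop :=
  forall x y : X, x <> y -> exists S, geodesic_segment x y S.

Definition busemann_space (X : metricType R) : Prop :=
  geodesic_space X /\
  forall (a b c d : R) (g g' : R -> X),
    affine_geodesic a b g -> affine_geodesic c d g' ->
    @convex_function R (R^o * R^o)%type (`[a, b] `*` `[c, d])
      (fun p => mdist (g p.1) (g' p.2)).

End busemann.

Section maps.
Context {R : realType} {X : metricType R}.

(* [gcomb l x y] is (1 - l) x (+) l y. In a Busemann space and for l in
   [0, 1] the set below is a singleton, so the default value of [xget] is
   irrelevant. *)
Definition gcomb (l : R) (x y : X) : X :=
  xget x [set z | mdist x z = l * mdist x y /\ mdist y z = (1 - l) * mdist x y].

Definition geodesically_convex (C : set X) : Prop :=
  forall x y l, C x -> C y -> 0 <= l <= 1 -> C (gcomb l x y).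

Definition nonexpansive (C : set X) (T : X -> X) : Prop :=
  forall x y, C x -> C y -> mdist (T x) (T y) <= mdist x y.

Definition firmly_nonexpansive (C : set X) (T : X -> X) : Prop :=
  forall x y l, C x -> C y -> 0 < l < 1 ->
    mdist (T x) (T y) <= mdist (gcomb l x (T x)) (gcomb l y (T y)).

(* The library's [is_contraction] is restricted to normed modules. *)
Definition self_contraction (C : set X) (f : X -> X) : Prop :=
  set_fun C C f /\
  exists2 k : R, 0 <= k < 1 &
    forall x y, C x -> C y -> mdist (f x) (f y) <= k * mdist x y.

Definition fixpoints (C : set X) (f : X -> X) : set X :=
  [set x | C x /\ f x = x].

(* [resolvent C T t x] is U_t(x). It is [x] when there is no fixed point and an
   arbitrary fixed point when there are several. *)
Definition resolvent (C : set X) (T : X -> X) (t : R) (x : X) : X :=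
  xget x (fixpoints C (fun y => gcomb t x (T y))).

End maps.

(* Main.v *)
Require Import Defs.
From mathcomp Require Import all_boot all_order all_algebra.
From mathcomp Require Import all_classical all_reals all_analysis.
From mathcomp Require Import lra ring.

Import Order.TTheory GRing.Theory Num.Theory.
Import numFieldNormedType.Exports.

Local Open Scope classical_set_scope.
Local Open Scope ring_scope.

(** Everything is computed along constant-speed paths on [0, 1]: the Busemann
    inequality bounds d (p s) (q s) by a convex combination of its values at two
    other times. Applied to two paths with common endpoints it gives the
    uniqueness of [gcomb], and applied to two paths from a common origin the
    contraction property, so that Banach's theorem defines the resolvent. For
    firm nonexpansiveness, put u = U_t x, v = U_t y, let p and q be the paths
    from x to T u and from y to T v, and write t = (1 - r) l t + r with r < 1:
    then
      d (p t) (q t) <= (1 - r) d (p (l t)) (q (l t)) + r d (T u) (T v)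
    with u = p t and v = q t. As d (T u) (T v) <= d u v, the last term is
    absorbed, and p (l t), q (l t) are the points (1 - l) x (+) l u and
    (1 - l) y (+) l v. *)

(** * Almost fixed points and constant-speed paths in a metric space *)

Section metric_space.
Context {R : realType} {X : metricType R}.
Implicit Types (x y z : X) (p q : R -> X).

Lemma mdist_le0 x y : mdist x y <= 0 -> x = y.
Proof.
by move=> d0; apply: mdist_positivity; apply/eqP; rewrite eq_le d0 mdist_ge0.
Qed.

(** For [k < 1], nearly fixed points are close to each other. This serves both for the Cauchy
    property in Banach's theorem and for the uniqueness of fixed points. *)
Lemma lipschitz_dist_le (C : set X) (f : X -> X) (k : R) :
  (forall x y, C x -> C y -> mdist (f x) (f y) <= k * mdist x y) ->
  forall x y, C x -> C y ->
    (1 - k) * mdist x y <= mdist x (f x) + mdist y (f y).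
Proof.
move=> fk x y Cx Cy; have := fk _ _ Cx Cy.
have := metric_triangle x (f x) y; have := metric_triangle (f x) (f y) y.
rewrite (metric_sym (f y) y); lra.
Qed.

(** The speed is the distance of the endpoints, so constant paths are included and [x = y] needs no
    separate treatment later. *)
Definition constant_speed p : Prop :=
  {in `[0, 1] &, forall s t, mdist (p s) (p t) = `|s - t| * mdist (p 0) (p 1)}.

(** The upper bounds on [0, s], [s, t] and [t, 1] sum to [mdist (p 0) (p 1)]; the triangle
    inequality then forces equality in each. *)
Lemma constant_speed_lipschitz p :
  (forall s t : R, 0 <= s -> s <= t -> t <= 1 ->
     mdist (p s) (p t) <= (t - s) * mdist (p 0) (p 1)) -> constant_speed p.
Proof.
move=> lip.
have eqD (s t : R) : 0 <= s -> s <= t -> t <= 1 ->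
    mdist (p s) (p t) = (t - s) * mdist (p 0) (p 1).
  move=> s0 st t1; apply/eqP; rewrite eq_le lip//=.
  have := metric_triangle (p 0) (p s) (p 1).
  have := metric_triangle (p s) (p t) (p 1).
  have := lip 0 s (lexx _) s0 (le_trans st t1).
  have := lip t 1 (le_trans s0 st) t1 (lexx _).
  lra.
move=> s t; rewrite !in_itv/= => /andP[s0 s1] /andP[t0 t1].
case: (leP s t) => st.
  by rewrite eqD// ler0_norm ?subr_le0// opprB.
by rewrite metric_sym [LHS]eqD ?(ltW st)// gtr0_norm ?subr_gt0.
Qed.

Lemma constant_speed0 p t : constant_speed p -> 0 <= t <= 1 ->
  mdist (p 0) (p t) = t * mdist (p 0) (p 1).
Proof.
move=> sp /andP[t0 t1].
by rewrite sp ?in_itv/= ?lexx ?ler01 ?t0// sub0r normrN ger0_norm.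
Qed.

Lemma constant_speed1 p t : constant_speed p -> 0 <= t <= 1 ->
  mdist (p 1) (p t) = (1 - t) * mdist (p 0) (p 1).
Proof.
move=> sp /andP[t0 t1].
by rewrite sp ?in_itv/= ?lexx ?ler01 ?t0// ger0_norm// subr_ge0.
Qed.

Lemma constant_speed_affine p : constant_speed p -> affine_geodesic 0 1 p.
Proof.
move=> sp; split; first exact: ler01.
have [D0|] := eqVneq (mdist (p 0) (p 1)) 0.
  left; exists (p 0) => s s01; apply/mdist_positivity.
  by rewrite sp ?D0 ?mulr0// in_itv/= lexx ler01.
set D := mdist _ _ => Dn0.
have D0 : 0 < D by rewrite lt_neqAle eq_sym Dn0 mdist_ge0.
right; exists 0, D, (fun u => p (u / D)); split=> //.
- split; first exact: ltW.
  move=> s t; rewrite !in_itv/= => /andP[s0 s1] /andP[t0 t1].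
  rewrite sp ?in_itv/= ?divr_ge0 ?ler_pdivrMr ?mul1r ?(ltW D0)//.
  by rewrite -mulrBl normrM normfV (gtr0_norm D0) divfK.
- move=> s _; rewrite /line_path /factor mulr0 add0r !subr0 divr1.
  by rewrite mulfK.
Qed.

(** Run [p] on [0, l] and [q] on [l, 1]. Only an upper bound is required, so times on different
    sides of [l] are handled by the triangle inequality through [r l]. *)
Lemma constant_speed_concat p q l : 0 <= l <= 1 ->
  constant_speed p -> constant_speed q -> p 1 = q 0 ->
  mdist (p 0) (p 1) = l * mdist (p 0) (q 1) ->
  mdist (q 0) (q 1) = (1 - l) * mdist (p 0) (q 1) ->
  exists r, [/\ constant_speed r, r 0 = p 0, r 1 = q 1 & r l = p 1].
Proof.
move=> /andP[l0 l1] sp sq pq Dp Dq.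
pose r s := if s <= l then p (s / l) else q ((s - l) / (1 - l)).
have lt_l s : l < s -> s <= 1 -> 0 < 1 - l.
  by move=> ls s1; rewrite subr_gt0 (lt_le_trans ls).
(* for l = 0 the quotients s / l below are 0 and p is constant *)
have r0 : r 0 = p 0 by rewrite /r l0 mul0r.
have rl : r l = p 1.
  rewrite /r lexx; have [l0'|ln0] := eqVneq l 0; last by rewrite divff.
  by rewrite l0' mul0r; apply: mdist_positivity; rewrite Dp l0' mul0r.
have r1 : r 1 = q 1.
  rewrite /r; case: (leP 1 l) => [l1'|ll].
    have -> : l = 1 by apply/eqP; rewrite eq_le l1.
    rewrite divr1 pq; apply: mdist_positivity.
    by rewrite Dq (_ : 1 - l = 0) ?mul0r//; lra.
  by rewrite divff// subr_eq0 gt_eqF.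
have scale s : 0 <= s -> s <= l -> [/\ 0 <= s / l, s / l <= 1 & s / l * l = s].
  move=> s0 sl; have [l0'|ln0] := eqVneq l 0.
    have -> : s = 0 by lra.
    by rewrite !mul0r ler01.
  have lp : 0 < l by rewrite lt_neqAle eq_sym ln0.
  by rewrite divr_ge0// ler_pdivrMr// mul1r sl divfK.
have left_side s t : 0 <= s -> s <= t -> t <= l ->
    mdist (r s) (r t) = (t - s) * mdist (r 0) (r 1).
  move=> s0 st tl; have sl := le_trans st tl.
  rewrite r0 r1 /r sl tl.
  have [sl0 sl1 sE] := scale _ s0 sl.
  have [tl0 tl1 tE] := scale _ (le_trans s0 st) tl.
  rewrite sp ?in_itv/= ?sl0 ?tl0// Dp mulrA; congr (_ * _).
  rewrite -[l in _ * l]ger0_norm// -normrM mulrBl sE tE.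
  by rewrite ler0_norm ?subr_le0// opprB.
have right_side s t : l <= s -> s <= t -> t <= 1 ->
    mdist (r s) (r t) = (t - s) * mdist (r 0) (r 1).
  (* At [u = l] the definition of [r] selects [p]; the two branches agree there because
     [p 1 = q 0]. *)
  have rE u : l <= u -> u <= 1 -> l < 1 -> r u = q ((u - l) / (1 - l)).
    move=> lu u1 ll; case: (ltgtP l u) lu => // [lu _|<- _].
      by rewrite /r leNgt lu.
    by rewrite rl subrr mul0r.
  move=> ls st t1; have s1 := le_trans st t1; have lt := le_trans ls st.
  case: (ltgtP l 1) l1 => // [ll _|ll _]; last first.
    have -> : s = t by lra.
    by rewrite mdistxx subrr mul0r.
  have l'0 : 0 < 1 - l by rewrite subr_gt0.
  rewrite r0 r1 !rE//.
  rewrite sq ?in_itv/= ?divr_ge0 ?subr_ge0 ?(ltW ll)// ?ler_pdivrMr ?mul1r//;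
    try lra.
  rewrite Dq mulrA; congr (_ * _).
  rewrite -mulrBl normrM normfV (gtr0_norm l'0) divfK ?gt_eqF//.
  by rewrite ler0_norm; lra.
exists r; split => //; apply: constant_speed_lipschitz => s t s0 st t1.
case: (leP t l) => tl; first by rewrite left_side.
case: (leP l s) => ls; first by rewrite right_side.
have := metric_triangle (r s) (r l) (r t).
rewrite (left_side s l) ?(ltW ls)// (right_side l t) ?(ltW tl)//; lra.
Qed.

End metric_space.

(** The steps of the iteration decay geometrically, and [lipschitz_dist_le] turns this directly into
    the Cauchy property, without summing a geometric series. *)
Theorem complete_banach_fixed_point (R : realType) (X : completeMetricType R)
    (C : set X) (f : X -> X) :
  C !=set0 -> closed C -> self_contraction C f -> fixpoints C f !=set0.
Proof.
move=> [x0 Cx0] Ccl [fC [k /andP[k0 k1] fk]].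
pose u n := iter n f x0; pose d := mdist x0 (f x0).
have Cu n : C (u n) by elim: n => //= n; exact: fC.
have uS n : mdist (u n) (u n.+1) <= k ^+ n * d.
  elim: n => [|n ih]; first by rewrite expr0 mul1r.
  rewrite exprS -mulrA; apply: le_trans (fk _ _ (Cu n) (Cu n.+1)) _.
  by rewrite ler_wpM2l.
have kd e : 0 < e -> \forall n \near \oo, k ^+ n * d < e.
  move=> e0; have : (fun n => k ^+ n * d) @ \oo --> 0 * d.
    by apply: cvgMr_tmp; apply: cvg_expr; rewrite ger0_norm.
  rewrite mul0r => /cvgrPdist_lt/(_ _ e0); apply: filterS => n.
  by rewrite sub0r normrN; apply: le_lt_trans; exact: ler_norm.
have : cvg (u @ \oo).
  apply: cauchy_cvg; apply: cauchy_exP => e e0.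
  have k'0 : 0 < 1 - k by rewrite subr_gt0.
  (* Two steps below [(1 - k) * e / 2] put the iterates within [e] of each other. *)
  have [N _ NP] := kd _ (divr_gt0 (mulr_gt0 k'0 e0) (ltr0Sn _ 1)).
  exists (u N); exists N => // n /= Nn; rewrite ballEmdist/=.
  rewrite -(ltr_pM2l k'0).
  have := lipschitz_dist_le _ _ _ fk _ _ (Cu N) (Cu n).
  have := NP N (leqnn N); have := NP n Nn; rewrite /=.
  have := uS N; have := uS n; rewrite /=; lra.
move=> /cvg_ex[l ul].
have Cl : C l by apply: closed_cvg ul => //; apply: nearW.
exists l; split=> //; apply: mdist_le0; apply/ler_addgt0Pr => e e0.
rewrite add0r.
(* Both [u N] and [u N.+1 = f (u N)] are within [e / 2] of [l], hence [f l] is within [e] of [l]. *)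
have [N _ NP] :=
  metricType_numDomainType.cvgr_dist_lt ul (divr_gt0 e0 (ltr0Sn _ 1)).
have := NP N (leqnn N); have := NP N.+1 (leqnSn N); rewrite /=.
have := metric_triangle (f l) (f (u N)) l; have := fk _ _ Cl (Cu N).
rewrite (metric_sym (f (u N)) l).
have : k * mdist l (u N) <= mdist l (u N) by rewrite ler_piMl ?mdist_ge0 ?ltW.
lra.
Qed.

(** * Convex combinations in a Busemann space *)

Section busemann.
Context {R : realType} {X : metricType R} (hX : busemann_space X).
Implicit Types (x y z : X) (p q : R -> X).

Lemma ex_constant_speed x y :
  exists p, [/\ constant_speed p, p 0 = x & p 1 = y].
Proof.
have [<-|/eqP xy] := eqVneq x y.
  by exists (cst x); split => // s t _ _; rewrite /cst/= mdistxx mulr0.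
have [_ [a [b [g [[ab geo] gx gy _]]]]] := hX.1 _ _ xy.
exists (g \o line_path a b); split; rewrite /= ?line_path0 ?line_path1//.
apply: constant_speed_lipschitz => s t s0 st t1 /=.
have itv r : 0 <= r -> r <= 1 -> line_path a b r \in `[a, b].
  move=> r0 r1; have := @mem_line_path_itvcc _ _ _ ab r.
  by rewrite /= !in_itv/= r0 r1 => /(_ isT).
rewrite line_path0 line_path1 !geo ?itv ?bound_itvE//; try lra.
rewrite !line_pathEl opprD addrACA subrr addr0 -mulrBl normrM.
rewrite [`|s - t|]distrC [`|t - s|]ger0_norm ?subr_ge0//.
by rewrite [`|b - a|]distrC.
Qed.

Lemma busemann_le p q s t l : constant_speed p -> constant_speed q ->
  0 <= s <= 1 -> 0 <= t <= 1 -> 0 <= l <= 1 ->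
  mdist (p ((1 - l) * s + l * t)) (q ((1 - l) * s + l * t)) <=
  (1 - l) * mdist (p s) (q s) + l * mdist (p t) (q t).
Proof.
move=> sp sq s01 t01 /andP[l0 l1].
have := hX.2 _ _ _ _ _ _
  (constant_speed_affine _ sp) (constant_speed_affine _ sq).
(* Convexity is used on the diagonal only; the weight [l] falls on the first point, so [(t, t)]
   comes first. *)
move=> /(_ (Itv01 l0 l1) (t, t) (s, s)); rewrite !inE/=.
move=> /(_ (conj t01 t01) (conj s01 s01)).
rewrite /conv/=/unstable.onem [X in _ <= X -> _]addrC.
by rewrite [X in p X](addrC (l * t)) [X in q X](addrC (l * t)).
Qed.

Lemma constant_speed_unique p q l : constant_speed p -> constant_speed q ->
  p 0 = q 0 -> p 1 = q 1 -> 0 <= l <= 1 -> p l = q l.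
Proof.
move=> sp sq pq0 pq1 l01; apply: mdist_le0.
have := @busemann_le p q 0 1 l sp sq; rewrite !lexx !ler01.
by move=> /(_ isT isT l01); rewrite pq0 pq1 !mdistxx !mulr0 !addr0 mulr1 add0r.
Qed.

(** The chosen point is known only by its distances to [p 0] and [p 1]. They allow the paths through
    it to be concatenated at constant speed, and the result agrees with [p] by uniqueness. *)
Lemma gcomb_constant_speed p l : constant_speed p -> 0 <= l <= 1 ->
  gcomb l (p 0) (p 1) = p l.
Proof.
move=> sp l01.
have [/= dl dr] : [set z | mdist (p 0) z = l * mdist (p 0) (p 1) /\
    mdist (p 1) z = (1 - l) * mdist (p 0) (p 1)] (gcomb l (p 0) (p 1)).
  apply: xgetPex; exists (p l).
  by split; [exact: constant_speed0|exact: constant_speed1].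
have [q [sq q0 q1]] := ex_constant_speed (p 0) (gcomb l (p 0) (p 1)).
have [r [sr r0 r1]] := ex_constant_speed (gcomb l (p 0) (p 1)) (p 1).
have [|||c [sc c0 c1 cl]] := constant_speed_concat _ _ _ l01 sq sr.
- by rewrite q1 r0.
- by rewrite q0 q1 r1.
- by rewrite r0 r1 q0 metric_sym.
by rewrite -q1 -cl; apply: constant_speed_unique => //; rewrite ?c0 ?c1.
Qed.

Lemma mdist_gcomb_le x y x' y' l : 0 <= l <= 1 ->
  mdist (gcomb l x x') (gcomb l y y') <=
  (1 - l) * mdist x y + l * mdist x' y'.
Proof.
move=> l01.
have [p [sp <- <-]] := ex_constant_speed x x'.
have [q [sq <- <-]] := ex_constant_speed y y'.
rewrite !gcomb_constant_speed//.
have := @busemann_le p q 0 1 l sp sq; rewrite !lexx !ler01.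
by move=> /(_ isT isT l01); rewrite !mulr0 add0r mulr1.
Qed.

Lemma gcombxx x l : gcomb l x x = x.
Proof.
apply: mdist_positivity; rewrite metric_sym.
have [] : [set z | mdist x z = l * mdist x x /\
    mdist x z = (1 - l) * mdist x x] (gcomb l x x).
  by apply: xgetPex; exists x; rewrite /= mdistxx !mulr0.
by rewrite mdistxx mulr0.
Qed.

Lemma mdist_gcomb x y l : 0 <= l <= 1 ->
  mdist x (gcomb l x y) = l * mdist x y.
Proof.
move=> l01; have [p [sp <- <-]] := ex_constant_speed x y.
by rewrite gcomb_constant_speed// constant_speed0.
Qed.

Lemma gcomb_gcombr z z' t l : 0 <= t <= 1 -> 0 <= l <= 1 ->
  gcomb l z (gcomb t z z') = gcomb (l * t) z z'.
Proof.
move=> t01 l01; have [t0 t1] := andP t01; have [l0 l1] := andP l01.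
have [p [sp <- <-]] := ex_constant_speed z z'.
rewrite !gcomb_constant_speed ?mulr_ge0 ?mulr_ile1//.
(* The initial piece of [p] up to time [t], rescaled to [0, 1]. *)
pose q s := p (s * t).
have sq : constant_speed q.
  apply: constant_speed_lipschitz => a b a0 ab b1; rewrite /q.
  have bt : b * t <= 1 by rewrite mulr_ile1// (le_trans a0).
  have at0 : 0 <= a * t by rewrite mulr_ge0.
  have abt : a * t <= b * t by rewrite ler_wpM2r.
  rewrite !mul0r mul1r constant_speed0// sp ?in_itv/=; last 2 first.
  - by rewrite at0 (le_trans abt).
  - by rewrite (le_trans at0 abt).
  by rewrite mulrA mulrBl ler0_norm ?subr_le0// opprB.
have <- : q 0 = p 0 by rewrite /q mul0r.
have <- : q 1 = p t by rewrite /q mul1r.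
by rewrite gcomb_constant_speed.
Qed.

(** With [x' = T u], [y' = T v] and [u], [v] the inner combinations, the last hypothesis is
    nonexpansiveness of [T] at [u] and [v]. *)
Lemma gcomb_gcomb_le x y x' y' t l : 0 <= t < 1 -> 0 <= l <= 1 ->
  mdist x' y' <= mdist (gcomb t x x') (gcomb t y y') ->
  mdist (gcomb t x x') (gcomb t y y') <=
  mdist (gcomb l x (gcomb t x x')) (gcomb l y (gcomb t y y')).
Proof.
move=> /andP[t0 t1] /andP[l0 l1].
have t01 : 0 <= t <= 1 by rewrite t0 ltW.
have lt0 : 0 <= l * t by rewrite mulr_ge0.
have ltt : l * t <= t by rewrite ler_piMl.
have lt01 : 0 <= l * t <= 1 by rewrite lt0 (le_trans ltt)// ltW.
rewrite !gcomb_gcombr ?l0//.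
have [p [sp <- <-]] := ex_constant_speed x x'.
have [q [sq <- <-]] := ex_constant_speed y y'.
rewrite !gcomb_constant_speed// => d1.
have lt1 : 0 < 1 - l * t by rewrite subr_gt0 (le_lt_trans ltt).
(* The weight that makes [t] a combination of [l * t] and 1. As [t < 1], also [r < 1], and the
   factor [1 - r] cancels at the end. *)
pose r := (t - l * t) / (1 - l * t).
have r0 : 0 <= r by rewrite divr_ge0 ?subr_ge0// ltW// -subr_gt0.
have r1 : r < 1 by rewrite ltr_pdivrMr// mul1r ltrD2r.
have tE : (1 - r) * (l * t) + r * 1 = t.
  by rewrite /r; field; rewrite gt_eqF.
have := @busemann_le p q (l * t) 1 r sp sq lt01.
rewrite tE ler01 lexx r0 (ltW r1).
move=> /(_ isT isT) /le_trans /(_ (lerD (lexx _) (ler_wpM2l r0 d1))).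
rewrite -lerBlDr -[X in X - _]mul1r -mulrBl.
by rewrite ler_pM2l ?subr_gt0.
Qed.

End busemann.

Theorem proposition3p2 (R : realType) (X : completeMetricType R)
    (hX : busemann_space X) (C : set X) (C0 : C !=set0) (Ccl : closed C)
    (Ccv : geodesically_convex C) (T : {fun C >-> C})
    (Tne : nonexpansive C T) (t : R) (t01 : 0 < t < 1) :
  [/\ forall x, C x -> self_contraction C (fun y => gcomb t x (T y)),
      forall x, C x ->
        unique (fixpoints C (fun y => gcomb t x (T y))) (resolvent C T t x),
      firmly_nonexpansive C (resolvent C T t) &
      fixpoints C (resolvent C T t) = fixpoints C T].
Proof.
have [t0 t1] := andP t01.
have t01' : 0 <= t <= 1 by rewrite !ltW.
have CT x : C x -> C (T x) by move=> Cx; exact: funS.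
have ctr x : C x -> self_contraction C (fun y => gcomb t x (T y)).
  move=> Cx; split=> [y Cy|]; first exact/Ccv/t01'/CT.
  exists t => [|y z Cy Cz]; first by rewrite ltW.
  apply: le_trans (mdist_gcomb_le hX x x (T y) (T z) _ t01') _.
  by rewrite mdistxx mulr0 add0r ler_wpM2l ?(ltW t0)// Tne.
have resolventP x : C x ->
    unique (fixpoints C (fun y => gcomb t x (T y))) (resolvent C T t x).
  move=> Cx.
  have [Cu uE] : fixpoints C (fun y => gcomb t x (T y)) (resolvent C T t x).
    by apply: xgetPex; apply: complete_banach_fixed_point => //; exact: ctr.
  split=> // y [Cy yE]; have [_ [k /andP[_ k1] fk]] := ctr _ Cx.
  apply: mdist_le0; have := lipschitz_dist_le _ _ _ fk _ _ Cu Cy.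
  by rewrite uE yE !mdistxx addr0 pmulr_rle0 ?subr_gt0.
split=> //.
- move=> x y l Cx Cy /andP[l0 l1].
  have [[Cu uE] _] := resolventP _ Cx; have [[Cv vE] _] := resolventP _ Cy.
  move: (resolvent C T t x) (resolvent C T t y) Cu Cv uE vE => u v Cu Cv uE vE.
  have := @gcomb_gcomb_le _ _ hX x y (T u) (T v) t l.
  by rewrite uE vE; apply; rewrite ?t1 ?(ltW t0) ?(ltW l0) ?(ltW l1)//;
    exact: Tne.
- apply/seteqP; split=> x [Cx xE]; split=> //.
    (* Here [x = gcomb t x (T x)] lies at distance [t * mdist x (T x)] from itself, and [t > 0]. *)
    have [[_ uE] _] := resolventP _ Cx.
    apply/esym/mdist_positivity/eqP.
    have := mdist_gcomb hX x (T x) t t01'.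
    move: uE; rewrite /= xE => ->; rewrite mdistxx => /esym/eqP.
    by rewrite mulf_eq0 gt_eqF.
  (* A fixed point [x] of [T] solves the equation defining [resolvent C T t x], whose solution is
     unique. *)
  by apply: (resolventP _ Cx).2; split=> //; rewrite xE gcombxx.
Qed.
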